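(* Let $\mathcal C=\mathcal C(I,A,(\rho_i)_{i\in I},(C^a)_{a\in A})$ be a Cartan scheme such that $\mathcal R^{\mathrm{re}}(\mathcal C)$ is a finite root system of type $\mathcal C$. Let $a\in A$ and $w\in \operatorname{Hom}(\mathcal W(\mathcal C),a)$. Then the map $2^{I_L(w)}\to \bar D_L(w)$, $J\mapsto w_J$, is an isomorphism of posets, where $2^{I_L(w)}$ is the set of subsets of $I_L(w)$ ordered by inclusion and $\bar D_L(w)$ is ordered by the weak order $\le_R$.
   Context: Cartan schemes. Let $I,A$ be finite sets, $A\neq\emptyset$, and $(\alpha_i)_{i\in I}$ the standard basis of $\mathbb Z^I$. A Cartan scheme $\mathcal C=\mathcal C(I,A,(\rho_i)_{i\in I},(C^a)_{a\in A})$ consists of maps $\rho_i:A\to A$ ($i\in I$) and (integer) generalized Cartan matrices $C^a=(c^a_{jk})_{j,k\in I}$ ($a\in A$) such that $\rho_i^2=\mathrm{id}$ and $c^a_{ij}=c^{\rho_i(a)}_{ij}$ for all $a\in A$, $i,j\in I$. Define $\sigma_i^a\in\operatorname{Aut}(\mathbb Z^I)$ by $\sigma_i^a(\alpha_j)=\alpha_j-c^a_{ij}\alpha_i$ for all $j\in I$. Weyl groupoid. $\mathcal W(\mathcal C)$ is the category (a groupoid) with object set $A$ whose morphisms are the compositions of the maps $\sigma_i^a$, each regarded as an element of $\operatorname{Hom}(a,\rho_i(a))$ (morphisms with the same source and target are equal iff they are equal as linear maps). Upper indices are omitted when determined by context; $\mathrm{id}^a\sigma_{i_1}\cdots\sigma_{i_k}$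 denotes the composition with target $a$. For a subgroupoid $\mathcal W'$ with object set $A$, $\operatorname{Hom}(\mathcal W',a)$ is the disjoint union over $b\in A$ of the sets of morphisms $b\to a$ in $\mathcal W'$. Roots. $(R^{\mathrm{re}})^a=\{\mathrm{id}^a\sigma_{i_1}\cdots\sigma_{i_k}(\alpha_j)\mid k\ge 0,\ i_1,\dots,i_k,j\in I\}$, and $\mathcal R^{\mathrm{re}}(\mathcal C)=(\mathcal C,((R^{\mathrm{re}})^a)_{a\in A})$. A family $(R^a)_{a\in A}$ of subsets of $\mathbb Z^I$ is a root system of type $\mathcal C$ if, with $R^a_+=R^a\cap\mathbb N_0^I$ and $m^a_{i,j}=|R^a\cap(\mathbb N_0\alpha_i+\mathbb N_0\alpha_j)|$: (R1) $R^a=R^a_+\cup -R^a_+$; (R2) $R^a\cap\mathbb Z\alpha_i=\{\alpha_i,-\alpha_i\}$; (R3) $\sigma_i^a(R^a)=R^{\rho_i(a)}$; (R4) if $i\ne j$ and $m^a_{i,j}$ is finite then $(\rho_i\rho_j)^{m^a_{i,j}}(a)=a$; for all $a\in A$, $i,j\in I$. It is finite if every $R^a$ is finite. Length and weak order. For a morphism $w$, $\ell(w)$ is the least $k\ge0$ such that $w$ is a composition $\sigma_{i_1}\cdots\sigma_{i_k}^b$. For $u\in\operatorname{Hom}(b,a)$, $v\in\operatorname{Hom}(c,b)$ put $u\le_R uv$ iff $\ell(u)+\ell(v)=\ell(uv)$; this is a partial order on $\operatorname{Hom}(\mathcal W(\mathcal C),a)$ (weak order). Parabolics and longest words. For $J\subseteq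 I$, $\mathcal W_J(\mathcal C)$ is the smallest subgroupoid of $\mathcal W(\mathcal C)$ containing all objects and all $\sigma_j^b$ with $j\in J$, $b\in A$. $w_J$ denotes the unique maximal element of $\operatorname{Hom}(\mathcal W_J(\mathcal C),a)$ with respect to weak order (it depends on the target object $a$). Descents. For $w\in\operatorname{Hom}(\mathcal W(\mathcal C),a)$: $I_L(w)=\{i\in I\mid \mathrm{id}^a\sigma_i\le_R w\}$ and $\bar D_L(w)=\{w_J\in\operatorname{Hom}(\mathcal W(\mathcal C),a)\mid J\subseteq I,\ w_J\le_R w\}$. *)

(* Defs.v *)
From HB Require Import structures.
From mathcomp Require Import all_boot all_order all_algebra.
From mathcomp Require Import boolp classical_sets functions cardinality.

Set Implicit Arguments.
Unset Strict Implicit.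
Unset Printing Implicit Defensive.

Import Order.TTheory GRing.Theory Num.Theory.
Local Open Scope classical_set_scope.
Local Open Scope ring_scope.

Notation ZI I := {ffun I -> int}.

Definition alpha (I : finType) (i : I) : ZI I := [ffun j => (j == i)%:Z].

Definition gen_cartan_matrix (I : finType) (c : I -> I -> int) : Prop :=
  [/\ forall i, c i i = 2,
      forall j k, j != k -> c j k <= 0
    & forall j k, c j k = 0 -> c k j = 0].

Record cartan_scheme (I A : finType) := CartanScheme {
  rho : I -> A -> A;
  cartan : A -> I -> I -> int;
  obj_nonempty : (0 < #|A|)%N;
  rho_invol : forall i a, rho i (rho i a) = a;
  cartan_gcm : forall a, gen_cartan_matrix (cartan a);
  cartan_rho : forall a i j, cartan a i j = cartan (rho i a) i j
}.

(* The additive extension of alpha j |-> alpha j - c^a_{ij} alpha i. *)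
Definition sigma (I A : finType) (C : cartan_scheme I A) (i : I) (a : A)
    (x : ZI I) : ZI I :=
  \sum_(j : I) (alpha j - alpha i *~ cartan C a i j) *~ x j.

Lemma sigma_alpha (I A : finType) (C : cartan_scheme I A) (i j : I) (a : A) :
  sigma C i a (alpha j) = alpha j - alpha i *~ cartan C a i j.
Proof.
rewrite /sigma (bigD1 j) //= big1 ?addr0 => [|k kj]; rewrite ffunE.
  by rewrite eqxx.
by rewrite (negbTE kj) mulr0z.
Qed.

(* A map of Z^I with a source and a target object; the morphisms of the Weyl
   groupoid are those in [weyl] below.  Leibniz equality of two of them is
   equality of source, target and (extensionally) of the maps. *)
Record mor (I A : finType) := Mor {
  src : A;
  tgt : A;
  fn : ZI I -> ZI I
}.

HB.instance Definition _ (I A : finType) := gen_eqMixin (mor I A).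
HB.instance Definition _ (I A : finType) := gen_choiceMixin (mor I A).

Definition idm (I A : finType) (a : A) : mor I A := Mor a a id.

(* Only meaningful when src u = tgt v. *)
Definition compm (I A : finType) (u v : mor I A) : mor I A :=
  Mor (src v) (tgt u) (fn u \o fn v).

Definition sigmam (I A : finType) (C : cartan_scheme I A) (i : I) (b : A) :
  mor I A := Mor b (rho C i b) (sigma C i b).

(* word C a [:: i_1; ...; i_k] is id^a sigma_{i_1} ... sigma_{i_k}: the letter
   with target a is sigma_i^{rho_i(a)}, since rho_i(rho_i(a)) = a. *)
Fixpoint word (I A : finType) (C : cartan_scheme I A) (a : A) (s : seq I) :
    mor I A :=
  if s is i :: s' then
    compm (sigmam C i (rho C i a)) (word C (rho C i a) s')
  else idm I a.

Definition weyl (I A : finType) (C : cartan_scheme I A) : set (mor I A) :=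
  [set w | exists (a : A) (s : seq I), w = word C a s].

Definition HomTo (I A : finType) (G : set (mor I A)) (a : A) : set (mor I A) :=
  [set w | G w /\ tgt w = a].

(* Subgroupoids of the Weyl groupoid with object set A. *)
Definition subgroupoid (I A : finType) (C : cartan_scheme I A)
    (G : set (mor I A)) : Prop :=
  [/\ G `<=` weyl C,
      forall a, G (idm I a),
      forall u v, G u -> G v -> src u = tgt v -> G (compm u v)
    & forall u v, G u -> weyl C v -> src u = tgt v -> src v = tgt u ->
        compm u v = idm I (tgt u) -> compm v u = idm I (src u) -> G v].

Definition parabolic (I A : finType) (C : cartan_scheme I A) (J : {set I}) :
    set (mor I A) :=
  smallest (subgroupoid C)
    [set u | exists (j : I) (b : A), j \in J /\ u = sigmam C j b].

Definition real_roots (I A : finType) (C : cartan_scheme I A) (a : A) :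
    set (ZI I) :=
  [set x | exists (s : seq I) (j : I), x = fn (word C a s) (alpha j)].

Definition positive_part (I : finType) (R : set (ZI I)) : set (ZI I) :=
  R `&` [set x | forall i, 0 <= x i].

Definition rank2_part (I : finType) (R : set (ZI I)) (i j : I) : set (ZI I) :=
  R `&` [set x | exists m n : nat, x = alpha i *+ m + alpha j *+ n].

(* In (R4), m^a_{i,j} is finite with value m iff rank2_part (R a) i j is
   equipotent to {0, ..., m-1}. *)
Definition root_system (I A : finType) (C : cartan_scheme I A)
    (R : A -> set (ZI I)) : Prop :=
  [/\ forall a, R a = positive_part (R a) `|` (-%R @` positive_part (R a)),
      forall a i, R a `&` [set x | exists n : int, x = alpha i *~ n] =
                  [set alpha i; - alpha i],
      forall a i, sigma C i a @` R a = R (rho C i a)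
    & forall a i j (m : nat), i != j -> (rank2_part (R a) i j #= `I_m)%card ->
        iter m (rho C i \o rho C j) a = a].

Definition finite_root_system (I A : finType) (C : cartan_scheme I A)
    (R : A -> set (ZI I)) : Prop :=
  root_system C R /\ forall a, finite_set (R a).

Definition has_word_of_size (I A : finType) (C : cartan_scheme I A)
    (w : mor I A) (k : nat) : Prop :=
  exists2 s : seq I, size s = k & w = word C (tgt w) s.

Definition len (I A : finType) (C : cartan_scheme I A) (w : mor I A) : nat :=
  xget 0%N [set k | has_word_of_size C w k /\
                    forall m, has_word_of_size C w m -> (k <= m)%N].

Definition leR (I A : finType) (C : cartan_scheme I A) (u w : mor I A) : Prop :=
  weyl C u /\
  exists v, [/\ weyl C v, src u = tgt v, w = compm u v
              & (len C u + len C v)%N = len C w].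

Definition maximal_in (T : Type) (D : set T) (le : T -> T -> Prop) : set T :=
  [set u | D u /\ forall v, D v -> le u v -> v = u].

(* w_J with target a: the unique maximal element of Hom(W_J(C), a); the default
   value idm I a is irrelevant whenever that element exists. *)
Definition longest (I A : finType) (C : cartan_scheme I A) (a : A)
    (J : {set I}) : mor I A :=
  xget (idm I a)
    [set u | unique (maximal_in (HomTo (parabolic C J) a) (leR C)) u].

Definition left_descents (I A : finType) (C : cartan_scheme I A) (a : A)
    (w : mor I A) : {set I} :=
  [set i : I | `[< leR C (word C a [:: i]) w >]]%SET.

Definition left_descent_longest (I A : finType) (C : cartan_scheme I A)
    (a : A) (w : mor I A) : set (mor I A) :=
  [set longest C a J | J in [set J : {set I} | leR C (longest C a J) w]].

Definition poset_iso (T U : Type) (D : set T) (leT : T -> T -> Prop)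
    (E : set U) (leU : U -> U -> Prop) (f : T -> U) : Prop :=
  set_bij D E f /\
  forall x y, D x -> D y -> (leT x y <-> leU (f x) (f y)).

(* Main.v *)
(* For w in the Weyl groupoid let n(w) be the number of positive roots made
   negative by w.  Left multiplication by sigma_i changes n by +1 or -1, and it
   decreases n iff w^-1(alpha_i) < 0; the main point is that n is the length.
   This follows from an exchange property, proved by induction: if w^-1 sends
   both alpha_i and alpha_j to negative roots, then w = x v with x an
   alternating word in i, j inverting all positive roots in the span of alpha_i
   and alpha_j, so the size of x is m_{i,j}; axiom (R4) and a determinant
   argument show that the two alternating words of that size coincide, so w also
   has a shortest word starting with j.

   Consequently i is a left descent of w iff w^-1(alpha_i) < 0.  An element of
   W_J without left descents in J is an identity, hence w_J is the only element
   of W_J with given target that has all of J as left descents.  Writing w = x v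
   with x in W_J, lengths adding up and v without left descents in J, all of J
   are descents of w iff x = w_J, so w_J <= w iff J is contained in I_L(w).
   As I_L(w_K) = K, the case w = w_K gives the order isomorphism. *)

Require Import Defs.
From mathcomp Require Import all_boot all_order all_algebra finmap ring zify.
From mathcomp Require Import boolp classical_sets functions cardinality.

Set Implicit Arguments.
Unset Strict Implicit.
Unset Printing Implicit Defensive.

Import Order.TTheory GRing.Theory Num.Theory.

Local Open Scope classical_set_scope.
Local Open Scope ring_scope.

(** * Sign, support and additive maps of [Z^I] *)

Definition nonneg {I : finType} (x : ZI I) : Prop := forall i, 0 <= x i.

Definition supported {I : finType} (J : {set I}) (x : ZI I) : Prop :=
  forall k, k \notin J -> x k = 0.

Lemma alphaE (I : finType) (i k : I) : alpha i k = (k == i)%:Z.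
Proof. by rewrite ffunE. Qed.

Lemma ZI_subE (I : finType) (x y : ZI I) k : (x - y) k = x k - y k.
Proof. by rewrite !ffunE. Qed.

Lemma nonneg_alpha (I : finType) (i : I) : nonneg (alpha i).
Proof. by move=> k; rewrite alphaE; case: eqP. Qed.

Lemma ZI_expand (I : finType) (x : ZI I) : x = \sum_i alpha i *~ x i.
Proof.
apply/ffunP => k; rewrite sum_ffunE (bigD1 k) //= big1 => [|i ik].
  by rewrite ffunMzE alphaE eqxx addr0 intz.
by rewrite ffunMzE alphaE eq_sym (negbTE ik) mul0rz.
Qed.

Lemma alpha_neq0 (I : finType) (i : I) : alpha i <> 0.
Proof. by move/ffunP/(_ i)/eqP; rewrite alphaE eqxx ffunE. Qed.

Lemma nonneg_antisym (I : finType) (x : ZI I) : nonneg x -> nonneg (- x) -> x = 0.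
Proof.
move=> x0 x1; apply/ffunP => i; apply/eqP.
by rewrite ffunE eq_le x0 andbT; have := x1 i; rewrite ffunE oppr_ge0.
Qed.

Section Additive.
Variables (I : finType) (f : ZI I -> ZI I).
Hypothesis fB : forall x y, f (x - y) = f x - f y.

Lemma add_fn0 : f 0 = 0. Proof. by rewrite -{1}(subrr 0) fB subrr. Qed.
Lemma add_fnN x : f (- x) = - f x. Proof. by rewrite -sub0r fB add_fn0 sub0r. Qed.
Lemma add_fnD x y : f (x + y) = f x + f y.
Proof. by rewrite -{1}[y]opprK fB add_fnN opprK. Qed.
Lemma add_fnMn x n : f (x *+ n) = f x *+ n.
Proof. by elim: n => [|n IH]; rewrite ?add_fn0 // !mulrS add_fnD IH. Qed.
Lemma add_fnMz x n : f (x *~ n) = f x *~ n.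
Proof. by case: n => n; rewrite ?NegzE ?mulrNz ?add_fnN -!pmulrn add_fnMn. Qed.

Lemma add_fn_expand x : f x = \sum_i f (alpha i) *~ x i.
Proof.
rewrite {1}[x]ZI_expand; elim/big_rec2: _ => [|i y z _ <-]; first exact: add_fn0.
by rewrite add_fnD add_fnMz.
Qed.

Lemma add_fn_nonneg (J : {set I}) x : supported J x -> nonneg x ->
  (forall j, j \in J -> nonneg (f (alpha j))) -> nonneg (f x).
Proof.
move=> xJ x0 fJ k; rewrite add_fn_expand sum_ffunE sumr_ge0 // => i _.
have [iJ|/xJ ->] := boolP (i \in J); last by rewrite mulr0z ffunE.
by rewrite ffunMzE mulrzz mulr_ge0 // fJ.
Qed.
End Additive.

(** * The Weyl groupoid *)

Section Groupoid.
Variables (I A : finType) (C : cartan_scheme I A).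
Implicit Types (a b : A) (i j k : I) (s t : seq I) (x y : ZI I) (u v w : mor I A).
Implicit Types (J K : {set I}).

Lemma sigmaE i a x :
  sigma C i a x = x - alpha i *~ (\sum_j cartan C a i j * x j).
Proof.
rewrite /sigma [X in X - _]ZI_expand mulrz_sumr -sumrB.
by apply: eq_bigr => j _; rewrite mulrzBl mulrzA.
Qed.

Lemma sigmaB i a x y : sigma C i a (x - y) = sigma C i a x - sigma C i a y.
Proof.
rewrite /sigma -sumrB; apply: eq_bigr => j _.
by rewrite !ffunE mulrzBr.
Qed.

Lemma sigma_out i a x k : k != i -> sigma C i a x k = x k.
Proof. by move=> ki; rewrite sigmaE !ffunE ffunMzE alphaE (negbTE ki) mul0rz subr0. Qed.

Lemma sigma_diag i a : sigma C i a (alpha i) = - alpha i.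
Proof.
by rewrite sigma_alpha; have [-> _ _] := cartan_gcm C a;
rewrite -[2]/(1 + 1) mulrzDr mulr1z opprD addNKr.
Qed.

Lemma sigmaK i a x : sigma C i a (sigma C i a x) = x.
Proof.
rewrite [X in sigma _ _ _ X]sigmaE sigmaB (add_fnMz (sigmaB i a)).
by rewrite sigma_diag sigmaE mulNrz opprK subrK.
Qed.

(** Row [i] of the Cartan matrix agrees at [a] and [rho C i a]; with [sigmaK] this makes the two
    morphisms at these objects mutually inverse. *)
Lemma sigma_rho i a : sigma C i (rho C i a) = sigma C i a.
Proof.
by apply/funext => x; rewrite !sigmaE; congr (_ - _ *~ _);
apply: eq_bigr => j _; rewrite -cartan_rho.
Qed.

Lemma tgt_word a s : tgt (word C a s) = a.
Proof. by case: s => //= i s; rewrite rho_invol. Qed.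

Lemma compmA u v w : compm u (compm v w) = compm (compm u v) w.
Proof. by []. Qed.

Lemma compm1l a w : tgt w = a -> compm (idm I a) w = w.
Proof. by case: w => b c f /= <-. Qed.

Lemma compm1r a w : src w = a -> compm w (idm I a) = w.
Proof. by case: w => b c f /= <-. Qed.

Lemma tgt_compm u v : tgt (compm u v) = tgt u. Proof. by []. Qed.

(** The object index is read off from [tgt w], so left multiplication is total and an involution
    without any composability condition. *)
Definition lmul i w := compm (sigmam C i (tgt w)) w.

Lemma word_cons a i s : word C a (i :: s) = lmul i (word C (rho C i a) s).
Proof. by rewrite /lmul tgt_word. Qed.

Lemma tgt_lmul i w : tgt (lmul i w) = rho C i (tgt w). Proof. by []. Qed.
Lemma src_lmul i w : src (lmul i w) = src w. Proof. by []. Qed.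
Lemma fn_lmul i w x : fn (lmul i w) x = sigma C i (tgt w) (fn w x). Proof. by []. Qed.

Lemma lmulK i w : lmul i (lmul i w) = w.
Proof.
case: w => b c f; rewrite /lmul /compm /= rho_invol; congr Mor.
by apply/funext => x /=; rewrite sigma_rho sigmaK.
Qed.

Lemma compm_lmul i u v : compm (lmul i u) v = lmul i (compm u v).
Proof. by []. Qed.

Lemma word_cat a s t :
  word C a (s ++ t) = compm (word C a s) (word C (src (word C a s)) t).
Proof.
elim: s a => [|i s IH] a; first by rewrite /= compm1l // tgt_word.
by rewrite cat_cons !word_cons IH src_lmul compm_lmul.
Qed.

(** Explicit form of membership in the parabolic subgroupoid, suited to induction on words;
    [parabolicP] proves the agreement. *)
Definition Jword (J : {set I}) w :=
  exists2 s, {subset s <= J} & w = word C (tgt w) s.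

Lemma Jword_id J a : Jword J (idm I a).
Proof. by exists [::]. Qed.

Lemma Jword_lmul J i w : i \in J -> Jword J w -> Jword J (lmul i w).
Proof.
move=> iJ [s sJ ew]; exists (i :: s).
  by move=> k; rewrite inE => /predU1P[-> //|/sJ].
by rewrite word_cons tgt_lmul rho_invol -ew.
Qed.

Lemma Jword_ind J (P : mor I A -> Prop) :
  (forall a, P (idm I a)) ->
  (forall i w, i \in J -> Jword J w -> P w -> P (lmul i w)) ->
  forall w, Jword J w -> P w.
Proof.
move=> P0 PS w [s sJ ->]; elim: s (tgt w) sJ => [|i s IH] a sJ; first exact: P0.
have sJ' : {subset s <= J} by move=> k ks; apply: sJ; rewrite inE ks orbT.
rewrite word_cons; apply: PS; [|by exists s; rewrite ?tgt_word|exact: IH].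
by apply: sJ; rewrite mem_head.
Qed.

Lemma Jword_comp J u v : src u = tgt v -> Jword J u -> Jword J v ->
  Jword J (compm u v).
Proof.
move=> + uJ vJ; elim/Jword_ind: uJ => [a /= ea|i {}u iJ _ IH /= /IH].
  by rewrite compm1l.
exact: Jword_lmul.
Qed.

Lemma JwordT w : weyl C w <-> Jword [set: I]%SET w.
Proof.
split=> [[a [s ->]]|[s _ ->]]; last by exists (tgt w), s.
by exists s => [? _|]; rewrite ?inE ?tgt_word.
Qed.

Lemma weyl_ind (P : mor I A -> Prop) :
  (forall a, P (idm I a)) ->
  (forall i w, weyl C w -> P w -> P (lmul i w)) ->
  forall w, weyl C w -> P w.
Proof.
by move=> P0 PS w /JwordT; elim/Jword_ind => // i u _ /JwordT uw; apply: PS.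
Qed.

Lemma weyl_word a s : weyl C (word C a s). Proof. by exists a, s. Qed.

Lemma weyl_id a : weyl C (idm I a). Proof. exact: (weyl_word a [::]). Qed.

Lemma weyl_comp u v : src u = tgt v -> weyl C u -> weyl C v -> weyl C (compm u v).
Proof. by rewrite !JwordT; apply: Jword_comp. Qed.

Lemma weyl_lmul i w : weyl C w -> weyl C (lmul i w).
Proof. by rewrite !JwordT; apply: Jword_lmul; rewrite inE. Qed.

Lemma Jword_weyl J w : Jword J w -> weyl C w.
Proof. by case=> s _ ->; apply: weyl_word. Qed.

Lemma weyl_sigma i a : weyl C (sigmam C i a).
Proof.
suff -> : sigmam C i a = lmul i (idm I a) by apply/weyl_lmul/weyl_id.
by [].
Qed.

Lemma fnB w x y : weyl C w -> fn w (x - y) = fn w x - fn w y.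
Proof.
by elim/weyl_ind => // i {}w _ IH; rewrite !fn_lmul IH sigmaB.
Qed.

Lemma Jword_out J w x k : Jword J w -> k \notin J -> fn w x k = x k.
Proof.
move=> wJ kJ; elim/Jword_ind: wJ => // i {}w iJ _ IH.
by rewrite fn_lmul sigma_out //; apply: contraNneq kJ => ->.
Qed.

(** * Inverses of morphisms *)

Definition inverse u v :=
  [/\ src u = tgt v, src v = tgt u, compm u v = idm I (tgt u)
    & compm v u = idm I (src u)].

Lemma inverse_sym u v : inverse u v -> inverse v u.
Proof. by case=> e1 e2 e3 e4; split=> //; rewrite ?e3 ?e4 ?e1 ?e2. Qed.

Lemma inverse_uniq u v v' : inverse u v -> inverse u v' -> v = v'.
Proof.
move=> [e1 e2 e3 e4] [e1' e2' e3' e4'].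
rewrite -[v](compm1r e2) -e3' compmA e4 compm1l //.
Qed.

Lemma inverse_comp u u' v v' : src u = tgt v -> inverse u u' -> inverse v v' ->
  inverse (compm u v) (compm v' u').
Proof.
move=> e [u1 u2 u3 u4] [v1 v2 v3 v4]; split=> //=.
  rewrite -compmA (compmA v) v3 compm1l ?u3 //; congruence.
rewrite -compmA (compmA u') u4 compm1l ?v4 //; congruence.
Qed.

Lemma inverse_sigma i a : inverse (sigmam C i a) (sigmam C i (rho C i a)).
Proof.
split=> //=; rewrite ?rho_invol // /compm /=; last rewrite /idm; congr Mor;
by rewrite ?rho_invol //; apply/funext => x /=; rewrite sigma_rho sigmaK.
Qed.

Lemma Jword_inverse J w : Jword J w -> exists2 v, Jword J v & inverse w v.
Proof.
elim/Jword_ind => [a|i {}w iJ _ [v vJ wv]]; first by exists (idm I a) => //; apply: Jword_id.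
exists (compm v (sigmam C i (rho C i (tgt w)))); last first.
  by apply: inverse_comp => //; apply: inverse_sigma.
apply: Jword_comp => //=; first by rewrite rho_invol; case: wv.
suff -> : sigmam C i (rho C i (tgt w)) = lmul i (idm I (rho C i (tgt w))).
  exact/Jword_lmul/Jword_id.
by [].
Qed.

(* The default value w is never used, as morphisms of the Weyl groupoid are
   invertible. *)
Definition invm w : mor I A := xget w [set v | inverse w v].

Lemma invmP w : weyl C w -> inverse w (invm w).
Proof.
move=> /JwordT /Jword_inverse [v _ wv].
by apply: (xgetPex w (P := [set v | inverse w v])); exists v.
Qed.

Lemma invm_eq w v : weyl C w -> inverse w v -> invm w = v.
Proof. by move=> ww; apply: inverse_uniq; apply: invmP. Qed.

Lemma Jword_inv J w : Jword J w -> Jword J (invm w).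
Proof.
move=> wJ; have [v vJ wv] := Jword_inverse wJ.
by rewrite (invm_eq (Jword_weyl wJ) wv).
Qed.

Lemma weyl_inv w : weyl C w -> weyl C (invm w).
Proof. by rewrite !JwordT; apply: Jword_inv. Qed.

Lemma src_invm w : weyl C w -> src (invm w) = tgt w.
Proof. by case/invmP. Qed.
Lemma tgt_invm w : weyl C w -> tgt (invm w) = src w.
Proof. by case/invmP. Qed.
Lemma invm_id a : invm (idm I a) = idm I a.
Proof. by apply: invm_eq => //; apply: weyl_id. Qed.
Lemma invmK w : weyl C w -> invm (invm w) = w.
Proof. by move=> ww; apply: invm_eq; [exact: weyl_inv|apply/inverse_sym/invmP]. Qed.
Lemma compmV w : weyl C w -> compm w (invm w) = idm I (tgt w).
Proof. by case/invmP. Qed.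
Lemma compVm w : weyl C w -> compm (invm w) w = idm I (src w).
Proof. by case/invmP. Qed.
Lemma fnK w x : weyl C w -> fn (invm w) (fn w x) = x.
Proof. by move=> /compVm /(congr1 (@fn I A)) /(congr1 (fun f => f x)). Qed.
Lemma fnVK w x : weyl C w -> fn w (fn (invm w) x) = x.
Proof. by move=> /compmV /(congr1 (@fn I A)) /(congr1 (fun f => f x)). Qed.

Lemma invm_comp u v : src u = tgt v -> weyl C u -> weyl C v ->
  invm (compm u v) = compm (invm v) (invm u).
Proof.
by move=> e uw vw; apply: invm_eq; [apply: weyl_comp|apply: inverse_comp => //; apply: invmP].
Qed.

Lemma invm_sigma i a : invm (sigmam C i a) = sigmam C i (rho C i a).
Proof. by apply: invm_eq; [apply: weyl_sigma|apply: inverse_sigma]. Qed.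

Lemma invm_lmul i w : weyl C w ->
  invm (lmul i w) = compm (invm w) (sigmam C i (rho C i (tgt w))).
Proof. by move=> ww; rewrite /lmul invm_comp ?invm_sigma //; apply: weyl_sigma. Qed.

Lemma fn_invm_lmul i w x : weyl C w ->
  fn (invm (lmul i w)) x = fn (invm w) (sigma C i (tgt w) x).
Proof. by move=> ww; rewrite invm_lmul //= sigma_rho. Qed.

End Groupoid.

(** * Inversions *)

Section FiniteRootSystem.
Variables (I A : finType) (C : cartan_scheme I A).
Hypothesis hfin : finite_root_system C (real_roots C).
Implicit Types (a b : A) (i j k : I) (s t : seq I) (x y : ZI I).
Implicit Types (u v w : mor I A).
Implicit Types (J K : {set I}).
Local Notation R := (real_roots C).

Lemma root_fn w x : weyl C w -> R (src w) x -> R (tgt w) (fn w x).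
Proof.
move=> [a [t ->]] [s [j ->]]; rewrite tgt_word.
by exists (t ++ s), j; rewrite word_cat.
Qed.

Lemma root_alpha a i : R a (alpha i).
Proof. by exists [::], i. Qed.

Lemma root_sign a x : R a x -> nonneg x \/ nonneg (- x).
Proof.
have [[R1 _ _ _] _] := hfin; rewrite R1 => -[[_ ?]|[y [_ y0] <-]]; first by left.
by right; rewrite opprK.
Qed.

Lemma rootN a x : R a x -> R a (- x).
Proof.
have [[R1 _ _ _] _] := hfin.
move=> Rx; have [x0|x0] := root_sign Rx; first by rewrite R1; right; exists x.
have : (positive_part (R a) `|` (-%R @` positive_part (R a))) x by rewrite -R1.
move=> [[_ x1]|[y [Ry _] <-]]; last by rewrite opprK.
by have x00 := nonneg_antisym x1 x0; rewrite x00 oppr0 -x00.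
Qed.

(** Real roots are images of simple roots under invertible additive maps. *)
Lemma root_neq0 a x : R a x -> x <> 0.
Proof.
move=> [s [j ->]] e.
have ww := weyl_word C a s; have := fnK (alpha j) ww.
rewrite e (add_fn0 (fun x y => fnB x y (weyl_inv ww))).
by move/esym/alpha_neq0.
Qed.

Lemma root_pos_neg a x : R a x -> nonneg x -> nonneg (- x) -> False.
Proof. by move=> /root_neq0 xn0 x0 /(nonneg_antisym x0). Qed.

Lemma root_pos_iff a x : R a x -> nonneg x <-> ~ nonneg (- x).
Proof.
move=> Rx; split=> [x0 x1|x1]; first exact: (root_pos_neg Rx).
by case: (root_sign Rx).
Qed.

Lemma root_coord_gt0 a x k : R a x -> 0 < x k -> nonneg x.
Proof.
move=> Rx xk; case: (root_sign Rx) => // /(_ k).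
by rewrite ffunE oppr_ge0 leNgt xk.
Qed.

(** By (R2) a positive root other than [alpha i] has a positive coordinate away from [i]. The
    reflection keeps that coordinate, and one positive coordinate decides the sign of a root. *)
Lemma sigma_pos a i x : R a x -> nonneg x -> x <> alpha i ->
  nonneg (sigma C i a x).
Proof.
move=> Rx x0 xi; have Rsx : R (rho C i a) (sigma C i a x).
  exact: (root_fn (weyl_sigma C i a)).
have [[k /andP[ki xk]]|/forallNP xE] :=
    pselect (exists k, (k != i) && (0 < x k)).
  by apply: (root_coord_gt0 (k := k) Rsx); rewrite sigma_out.
have {}xE : x = alpha i *~ x i.
  apply/ffunP => k; rewrite ffunMzE alphaE.
  have [->|ki] := eqVneq k i; first by rewrite intz.
  rewrite mul0rz; apply/eqP; rewrite eq_le x0 andbT leNgt.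
  by apply/negP => xk; apply: (xE k); rewrite ki.
have [[_ R2 _ _] _] := hfin.
have : (R a `&` [set y | exists n : int, y = alpha i *~ n]) x by split=> //; exists (x i).
rewrite R2 => -[//|/= xN].
by case: (root_pos_neg Rx x0); rewrite xN opprK; apply: nonneg_alpha.
Qed.

Definition inversions w : set (ZI I) :=
  [set x | [/\ R (src w) x, nonneg x & nonneg (- fn w x)]].

Lemma finite_inversions w : finite_set (inversions w).
Proof.
have [_ fin] := hfin; apply: sub_finite_set (fin (src w)).
by move=> x [].
Qed.

Definition ninv w : nat := #|` fset_set (inversions w)|.

Lemma le_card_fset_set (T : choiceType) (S S' : set T) : finite_set S' -> S `<=` S' ->
  (#|` fset_set S| <= #|` fset_set S'|)%N.
Proof.
move=> fS' SS'; have fS := sub_finite_set SS' fS'.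
by apply: fsubset_leq_card; rewrite -fset_set_sub.
Qed.

(** Root-theoretic criterion for a left descent; [desc_leR] identifies it with the one given by the
    weak order. *)
Definition desc i w := nonneg (- fn (invm w) (alpha i)).

Lemma root_invm w i : weyl C w -> R (src w) (fn (invm w) (alpha i)).
Proof.
move=> ww; rewrite -(tgt_invm ww); apply: root_fn; first exact: weyl_inv.
exact: root_alpha.
Qed.

Lemma ndesc i w : weyl C w -> ~ desc i w -> nonneg (fn (invm w) (alpha i)).
Proof. by move=> ww; apply: (root_pos_iff (root_invm i ww)).2. Qed.

(** The reflection changes the sign of no root except [alpha i] and its negative, so the only new
    inversion is the preimage [z] of [alpha i], and no old one is lost. *)
Lemma ninv_lmul i w : weyl C w -> ~ desc i w -> ninv (lmul C i w) = (ninv w).+1.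
Proof.
move=> ww /(ndesc ww); set z := fn _ _ => z0.
have wz : fn w z = alpha i by exact: (fnVK _ ww).
have Rz : R (src w) z by exact: root_invm.
have fwN x : fn w (- x) = - fn w x by apply/add_fnN => *; apply: fnB ww.
rewrite /ninv.
suff -> : inversions (lmul C i w) = z |` inversions w.
  rewrite fset_setU1; last exact: finite_inversions.
  rewrite cardfsU1 in_fset_set; last exact: finite_inversions.
  rewrite memNset ?add1n // => -[_ _]; rewrite wz.
  by apply: (root_pos_neg (root_alpha (src w) i)); apply: nonneg_alpha.
apply/seteqP; split=> x.
  move=> [Rx x0]; rewrite fn_lmul => sx.
  have [xz|xz] := pselect (fn w x = alpha i).
    by left; rewrite /= -[x](fnK _ ww) xz.
  right; split=> //; have Rwx := root_fn ww Rx.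
  case: (root_sign Rwx) => // wx0.
  case: (root_pos_neg (root_fn (weyl_lmul i ww) Rx)) => //.
  exact: sigma_pos.
move=> [->|[Rx x0 wx]]; split=> //.
  by rewrite fn_lmul wz sigma_diag opprK; apply: nonneg_alpha.
rewrite fn_lmul -(add_fnN (sigmaB C i _)); apply: sigma_pos => //.
  by apply: rootN; apply: root_fn.
(* If [- fn w x] were [alpha i], then [- x] would be [z], although both [x] and [z] are positive. *)
rewrite -fwN -wz => /(congr1 (fn (invm w))); rewrite !(fnK _ ww) => xz.
by apply: (root_pos_neg Rz) => //; rewrite -xz opprK.
Qed.

Lemma desc_lmul i w : weyl C w -> desc i (lmul C i w) <-> ~ desc i w.
Proof.
move=> ww; rewrite /desc fn_invm_lmul // sigma_diag.
rewrite (add_fnN (fun x y => fnB x y (weyl_inv ww))) opprK.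
exact: (root_pos_iff (root_invm i ww)).
Qed.

Lemma ninv_lmul_desc i w : weyl C w -> desc i w -> ninv w = (ninv (lmul C i w)).+1.
Proof.
move=> ww dw; rewrite -[in LHS](lmulK C i w) ninv_lmul //; first exact: weyl_lmul.
by move/(desc_lmul i ww).
Qed.

Lemma ninv_lmul_le i w : weyl C w -> (ninv (lmul C i w) <= (ninv w).+1)%N.
Proof.
move=> ww; have [dw|dw] := pselect (desc i w); last by rewrite ninv_lmul.
by rewrite (ninv_lmul_desc ww dw) ltnW // ltnW.
Qed.

Lemma ninv_id a : ninv (idm I a) = 0%N.
Proof.
rewrite /ninv (_ : inversions _ = set0) ?fset_set0 ?cardfs0 // -subset0 => x [Rx x0 x1].
exact: (root_pos_neg Rx).
Qed.

Lemma ninv_word a s : (ninv (word C a s) <= size s)%N.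
Proof.
elim: s a => [|i s IH] a; first by rewrite ninv_id.
rewrite word_cons (leq_trans (ninv_lmul_le _ _)) ?ltnS //; exact: weyl_word.
Qed.

(** The map sending [x] to [- fn w x] is a bijection from the inversions of [w] onto those of its
    inverse. *)
Lemma ninv_invm w : weyl C w -> ninv (invm w) = ninv w.
Proof.
move=> ww; rewrite /ninv.
have fwN x : fn w (- x) = - fn w x by apply/add_fnN => *; apply: fnB ww.
have fvN x : fn (invm w) (- x) = - fn (invm w) x.
  by apply: add_fnN => *; apply: fnB (weyl_inv ww).
have -> : inversions (invm w) = (fun x => - fn w x) @` inversions w.
  apply/seteqP; split=> x.
    move=> [Rx x0 x1]; exists (- fn (invm w) x); last by rewrite fwN (fnVK _ ww) opprK.
    split; rewrite ?fwN ?(fnVK _ ww) ?opprK //.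
    by apply: rootN; rewrite -(tgt_invm ww); apply/root_fn/Rx/weyl_inv.
  move=> [y [Ry y0 y1] <-]; split=> //.
    by apply: rootN; rewrite (src_invm ww); apply: root_fn.
  by rewrite fvN (fnK _ ww) opprK.
rewrite fset_set_image; last exact: finite_inversions.
rewrite card_imfset //= => x y /oppr_inj /(congr1 (fn (invm w))).
by rewrite !(fnK _ ww).
Qed.


(** A root inverted by the composite is either inverted by [v] or mapped by [v] to an inversion of
    [u]. *)
Lemma ninv_comp u v : weyl C u -> weyl C v -> src u = tgt v ->
  (ninv (compm u v) <= ninv u + ninv v)%N.
Proof.
move=> uw vw e.
apply: (@leq_trans #|` fset_set (fn (invm v) @` inversions u `|` inversions v)|).
  apply: le_card_fset_set.
    rewrite finite_setU; split; last exact: finite_inversions.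
    exact/finite_image/finite_inversions.
  move=> x [Rx x0 x1]; have Rvx := root_fn vw Rx.
  have [vx0|vx0] := root_sign Rvx; last by right.
  by left; exists (fn v x); rewrite ?(fnK _ vw) //; split; rewrite // e.
rewrite fset_setU; first last.
- exact: finite_inversions.
- exact/finite_image/finite_inversions.
rewrite (leq_trans (leq_card_fsetU _ _)) // leq_add2r.
rewrite fset_set_image; last exact: finite_inversions.
exact: leq_imfset_card.
Qed.

Lemma ndesc_id a i : ~ desc i (idm I a).
Proof.
rewrite /desc (invm_id C) => i0.
exact: (root_pos_neg (root_alpha a i) (@nonneg_alpha _ i)).
Qed.

(** * Positive roots supported in [J], a bound for the length inside the parabolic *)

Definition pos_roots J a : set (ZI I) :=
  [set x | [/\ R a x, nonneg x & supported J x]].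

Lemma finite_pos_roots J a : finite_set (pos_roots J a).
Proof. by have [_ /(_ a)] := hfin; apply: sub_finite_set => x []. Qed.

Lemma Jword_supported J w x : Jword C J w -> supported J x -> supported J (fn w x).
Proof. by move=> wJ xJ k kJ; rewrite (Jword_out _ wJ) ?xJ. Qed.

Lemma supported_alpha J j : j \in J -> supported J (alpha j).
Proof. by move=> jJ k kJ; rewrite alphaE; case: eqP kJ => // ->; rewrite jJ. Qed.

(** Coordinates outside [J] are unchanged by the inverse of [w]; on an inversion they are both at
    least 0 and at most 0. *)
Lemma inversions_sub J w : Jword C J w -> inversions (invm w) `<=` pos_roots J (tgt w).
Proof.
move=> wJ x [Rx x0 x1]; split=> //; first by rewrite -(src_invm (Jword_weyl wJ)).
move=> k kJ; apply/eqP; rewrite eq_le x0 andbT.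
by have := x1 k; rewrite ffunE (Jword_out _ (Jword_inv wJ)) // oppr_ge0.
Qed.

Definition all_desc J w := forall j, j \in J -> desc j w.

Lemma fn_neg J w x : weyl C w -> (forall j, j \in J -> nonneg (- fn w (alpha j))) ->
  supported J x -> nonneg x -> nonneg (- fn w x).
Proof.
move=> ww dw xJ x0; apply: (add_fn_nonneg (f := fun x => - fn w x) _ xJ x0) => // y z.
by rewrite (fnB _ _ ww) opprB opprK addrC.
Qed.

Lemma all_desc_neg J w x : weyl C w -> all_desc J w -> supported J x -> nonneg x ->
  nonneg (- fn (invm w) x).
Proof. by move=> /weyl_inv; apply: fn_neg. Qed.

Lemma all_desc_inversions J w : Jword C J w -> all_desc J w ->
  inversions (invm w) = pos_roots J (tgt w).
Proof.
move=> wJ dw; have ww := Jword_weyl wJ; apply/seteqP; split; first exact: inversions_sub.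
move=> x [Rx x0 xJ]; split; rewrite ?(src_invm ww) //.
exact: all_desc_neg xJ x0.
Qed.

Lemma ninv_le_pos_roots J w : Jword C J w ->
  (ninv w <= #|` fset_set (pos_roots J (tgt w))|)%N.
Proof.
move=> wJ; rewrite -(ninv_invm (Jword_weyl wJ)).
by apply: le_card_fset_set; [apply: finite_pos_roots|apply: inversions_sub].
Qed.

(** Having all of [J] as descents means inverting every positive root supported in [J]; by the
    inclusion [inversions_sub] this can be tested on cardinalities. *)
Lemma all_descP J w : Jword C J w ->
  all_desc J w <-> ninv w = #|` fset_set (pos_roots J (tgt w))|.
Proof.
move=> wJ; have ww := Jword_weyl wJ; rewrite -(ninv_invm ww).
split=> [dw|e j jJ]; first by rewrite /ninv (all_desc_inversions wJ).
suff : inversions (invm w) (alpha j) by case.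
have fI := finite_inversions (invm w); have fP := finite_pos_roots J (tgt w).
rewrite (_ : inversions _ = pos_roots J (tgt w)).
  by split; [apply: root_alpha|apply: nonneg_alpha|apply: supported_alpha].
apply: fset_set_inj => //; apply/eqP; rewrite eqEfcard -e leqnn andbT.
by rewrite -fset_set_sub //; apply: inversions_sub.
Qed.

(** Were the preimage of [alpha j] positive, [w] would make it negative, since it is supported in
    [J]; but [w] maps it to [alpha j]. *)
Lemma all_desc_invm J w : Jword C J w -> all_desc J (invm w) -> all_desc J w.
Proof.
move=> wJ dw j jJ; have ww := Jword_weyl wJ; rewrite /desc.
have Rj := root_invm j ww; case: (root_sign Rj) => // j0.
case: (root_pos_neg (root_alpha (tgt w) j)); first exact: nonneg_alpha.
rewrite -{1}(fnVK (alpha j) ww) -{1}(invmK ww).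
apply: all_desc_neg dw _ j0; first exact: weyl_inv.
exact/(Jword_supported (Jword_inv wJ))/supported_alpha.
Qed.

(** * Rank two *)

Fixpoint alt i j m : seq I := if m is m'.+1 then i :: alt j i m' else [::].

Lemma size_alt i j m : size (alt i j m) = m.
Proof. by elim: m i j => //= m IH i j; rewrite IH. Qed.

Lemma alt_sub i j m : {subset alt i j m <= [set i; j]%SET}.
Proof.
elim: m i j => [|m IH] i j // k; rewrite inE => /predU1P[->|/IH].
  by rewrite !inE eqxx.
by rewrite !inE orbC.
Qed.

Lemma alt_rcons i j m : alt i j m.+1 = rcons (alt i j m) (if odd m then j else i).
Proof. by elim: m i j => // m IH i j; rewrite [LHS]/= -/(alt j i m.+1) IH /=; case: odd. Qed.

Lemma Jword_alt a i j m : Jword C [set i; j]%SET (word C a (alt i j m)).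
Proof. by exists (alt i j m); [apply: alt_sub|rewrite tgt_word]. Qed.

Lemma invm_word_rcons a s i :
  invm (word C a (rcons s i)) = lmul C i (invm (word C a s)).
Proof.
have ww := weyl_word C a s.
rewrite -cats1 word_cat /=; set b := src _.
rewrite compm1r // (invm_comp _ ww (weyl_sigma C i _)); last by rewrite /= rho_invol.
by rewrite invm_sigma rho_invol /lmul (tgt_invm ww).
Qed.

(** Alternating words stay reduced until all positive roots of the plane are inverted. If appending
    a letter failed to increase the length, both letters would be descents of the inverse word,
    which then already has the maximal length. *)
Lemma ninv_alt a i j m :
  (m <= #|` fset_set (pos_roots [set i; j]%SET a)|)%N ->
  ninv (word C a (alt i j m)) = m.
Proof.
elim: m => [|m IH] mM; first by rewrite ninv_id.
(* Passing to inverses turns the appended letter into a left factor. *)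
rewrite alt_rcons -ninv_invm; last exact: weyl_word.
rewrite invm_word_rcons ninv_lmul; first by rewrite ninv_invm ?IH ?(ltnW mM) //; apply: weyl_word.
  exact/weyl_inv/weyl_word.
case: m => [|m] in IH mM * => d1.
  by case: (@ndesc_id (src (idm I a)) i); rewrite /= !(invm_id C) in d1.
have uJ := Jword_alt a i j m.+1; have uw := Jword_weyl uJ.
suff /(all_desc_invm uJ)/(all_descP uJ) : all_desc [set i; j]%SET (invm (word C a (alt i j m.+1))).
  by rewrite tgt_word IH 1?ltnW // => e; rewrite -e ltnn in mM.
(* The last letter of a reduced word is a descent of the inverse: otherwise the prefix of size [m]
   would have more than [m] inversions. *)
have d2 : desc (if odd m then j else i) (invm (word C a (alt i j m.+1))).
  have vw := weyl_word C a (alt i j m); have vw' := weyl_inv vw.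
  rewrite alt_rcons invm_word_rcons; apply/desc_lmul => // d.
  have := IH (ltnW mM); rewrite -(ninv_invm uw) alt_rcons invm_word_rcons => e.
  have := ninv_lmul_desc vw' d; rewrite e ninv_invm // => e2.
  by have := ninv_word a (alt i j m); rewrite size_alt e2 ltnNge leqnSn.
move=> k; rewrite !inE => /orP[] /eqP ->; move: d1 d2; rewrite /=; by case: odd.
Qed.


(* Each sigma_l with l in {i, j} changes the sign of this determinant, which
   excludes that a product of an even number of them exchanges alpha_i and
   alpha_j. *)
Definition area i j x y : int := x i * y j - x j * y i.

Lemma sigma_in2 a i j x : i != j -> supported [set i; j]%SET x ->
  sigma C i a x i = - x i - cartan C a i j * x j.
Proof.
move=> ij xJ; rewrite sigmaE !ffunE ffunMzE alphaE eqxx intz.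
rewrite (bigD1 i) // (bigD1 j) 1?eq_sym //= big1 => [|k /andP[ki kj]].
  by have [-> _ _] := cartan_gcm C a; ring.
by rewrite xJ ?mulr0 // !inE negb_or ki.
Qed.

Lemma area_sigma a i j l x y : i != j -> l \in [set i; j]%SET ->
  supported [set i; j]%SET x -> supported [set i; j]%SET y ->
  area i j (sigma C l a x) (sigma C l a y) = - area i j x y.
Proof.
move=> ij + xJ yJ; rewrite /area !inE => /orP[/eqP->|/eqP->].
  have ji : j != i by rewrite eq_sym.
  by rewrite (sigma_in2 _ ij xJ) (sigma_in2 _ ij yJ) !(sigma_out C _ _ ji); ring.
rewrite finset.setUC in xJ yJ; have ji : j != i by rewrite eq_sym.
by rewrite (sigma_in2 _ ji xJ) (sigma_in2 _ ji yJ) !(sigma_out C _ _ ij); ring.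
Qed.

Lemma area_word a i j s x y : i != j -> {subset s <= [set i; j]%SET} ->
  supported [set i; j]%SET x -> supported [set i; j]%SET y ->
  area i j (fn (word C a s) x) (fn (word C a s) y) = (-1) ^+ size s * area i j x y.
Proof.
move=> ij + xJ yJ; elim: s a => [|l s IH] a sJ; first by rewrite mul1r.
have sJ' : {subset s <= [set i; j]%SET} by move=> k ks; apply: sJ; rewrite inE ks orbT.
have wJ : Jword C [set i; j]%SET (word C (rho C l a) s) by exists s; rewrite ?tgt_word.
rewrite word_cons !fn_lmul area_sigma ?IH //=; first by rewrite exprS mulN1r mulNr.
- by apply: sJ; rewrite mem_head.
- exact: Jword_supported.
- exact: Jword_supported.
Qed.

Lemma supported2_expand i j x : i != j -> supported [set i; j]%SET x ->
  x = alpha i *~ x i + alpha j *~ x j.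
Proof.
move=> ij xJ; rewrite [LHS]ZI_expand (bigD1 i) // (bigD1 j) 1?eq_sym //= big1 ?addr0 //.
by move=> k /andP[ki kj]; rewrite xJ ?mulr0z // !inE negb_or ki.
Qed.

(* A 2x2 matrix of determinant 1 with nonnegative entries whose inverse is also
   nonnegative is the identity. *)
Lemma rank2_fix i j f g : i != j ->
    (forall x y, f (x - y) = f x - f y) -> (forall x, f (g x) = x) ->
    (forall l, l \in [set i; j]%SET -> supported [set i; j]%SET (f (alpha l))) ->
    (forall l, l \in [set i; j]%SET -> supported [set i; j]%SET (g (alpha l))) ->
    (forall l, l \in [set i; j]%SET -> nonneg (f (alpha l))) ->
    (forall l, l \in [set i; j]%SET -> nonneg (g (alpha l))) ->
    area i j (f (alpha i)) (f (alpha j)) = 1 ->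
    area i j (g (alpha i)) (g (alpha j)) = 1 ->
  forall l, l \in [set i; j]%SET -> f (alpha l) = alpha l.
Proof.
move=> ij fB fg fJ gJ f0 g0 fA gA.
have iJ : i \in [set i; j]%SET by rewrite !inE eqxx.
have jJ : j \in [set i; j]%SET by rewrite !inE eqxx orbT.
have fgE l m : l \in [set i; j]%SET ->
    f (alpha i) m * g (alpha l) i + f (alpha j) m * g (alpha l) j = (m == l)%:Z.
  move=> lJ; rewrite -alphaE -[in RHS](fg (alpha l)) [in RHS](supported2_expand ij (gJ _ lJ)).
  by rewrite (add_fnD fB) !(add_fnMz fB) ffunE !ffunMzE !mulrzz.
move: fA gA (fgE i i iJ) (fgE j i jJ) (fgE i j iJ) (fgE j j jJ).
move: (f0 i iJ i) (f0 i iJ j) (f0 j jJ i) (f0 j jJ j).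
move: (g0 i iJ i) (g0 i iJ j) (g0 j jJ i) (g0 j jJ j).
rewrite !eqxx (eq_sym j) (negbTE ij) /area.
set p := f _ i; set q := f _ j; set r := f _ i; set s := f _ j.
set p' := g _ i; set q' := g _ j; set r' := g _ i; set s' := g _ j.
move=> p'0 q'0 r'0 s'0 p0 q0 r0 s0 fA gA e1 e2 e3 e4.
have qp' := mulr_ge0 q0 p'0; have sq' := mulr_ge0 s0 q'0.
have pr' := mulr_ge0 p0 r'0; have rs' := mulr_ge0 r0 s'0.
have rq' := mulr_ge0 r'0 q'0.
(* The off-diagonal entries of the product are sums of nonnegative terms, so each term vanishes. A
   zero diagonal entry of [g] would make its determinant at most 0. *)
have q_0 : q = 0.
  have /eqP : q * p' = 0 by lia.
  by rewrite mulf_eq0 => /orP[/eqP //|/eqP p'E]; move: gA; rewrite p'E mul0r; lia.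
have r_0 : r = 0.
  have /eqP : r * s' = 0 by lia.
  by rewrite mulf_eq0 => /orP[/eqP //|/eqP s'E]; move: gA; rewrite s'E mulr0; lia.
have {}fA : p * s = 1 by move: fA; rewrite q_0 mul0r subr0.
have p_1 : p = 1.
  have pn0 : p <> 0 by move=> p_0; rewrite p_0 mul0r in fA.
  have sn0 : s <> 0 by move=> s_0; rewrite s_0 mulr0 in fA.
  (* As [p * s = 1], this product equals [2 - p - s]. *)
  have : 0 <= (p - 1) * (s - 1) by rewrite mulr_ge0 // subr_ge0; lia.
  by rewrite mulrBl mulrBr fA; lia.
have s_1 : s = 1 by move: fA; rewrite p_1 mul1r.
move=> l; rewrite !inE => /orP[] /eqP ->; rewrite [LHS](supported2_expand ij) //; try exact: fJ.
  by rewrite -/p -/q q_0 p_1 mulr0z addr0.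
by rewrite -/r -/s r_0 s_1 mulr0z add0r.
Qed.

(** The coordinate at [k] stays 1, so the image of [alpha k] is a positive root, and it differs from
    [alpha k] only inside [J]. *)
Lemma fix_out J w k : Jword C J w ->
  (forall j, j \in J -> fn w (alpha j) = alpha j) -> k \notin J ->
  exists2 x, supported J x & nonneg x /\ fn w (alpha k) = alpha k + x.
Proof.
move=> wJ wj kJ; have ww := Jword_weyl wJ.
exists (fn w (alpha k) - alpha k); last split; last by rewrite addrC subrK.
  by move=> l lJ; rewrite ZI_subE (Jword_out _ wJ lJ) subrr.
have Rk : R (tgt w) (fn w (alpha k)) by apply: root_fn => //; apply: root_alpha.
have := @root_coord_gt0 _ _ k Rk; rewrite (Jword_out _ wJ kJ) alphaE eqxx => /(_ isT) k0.
move=> l; rewrite ZI_subE; have [->|lk] := eqVneq l k.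
  by rewrite (Jword_out _ wJ kJ) subrr.
by rewrite [X in _ - X]alphaE (negbTE lk) subr0; apply: k0.
Qed.

(* Outside J, w and w^-1 add nonnegative vectors p and q supported in J to a
   simple root; as w fixes q, p + q = 0. *)
Lemma Jword_fix J w : Jword C J w ->
  (forall j, j \in J -> fn w (alpha j) = alpha j) -> fn w = id.
Proof.
move=> wJ wj; have ww := Jword_weyl wJ.
have vj j : j \in J -> fn (invm w) (alpha j) = alpha j.
  by move=> jJ; rewrite -{1}(wj _ jJ) (fnK _ ww).
have fixJ x : supported J x -> fn w x = x.
  move=> xJ; rewrite (add_fn_expand (fun x y => fnB x y ww)) [RHS]ZI_expand.
  apply: eq_bigr => k _; have [/wj -> //|/xJ ->] := boolP (k \in J).
  by rewrite !mulr0z.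
suff fixa k : fn w (alpha k) = alpha k.
  apply/funext => x; rewrite (add_fn_expand (fun x y => fnB x y ww)) [RHS]ZI_expand.
  by apply: eq_bigr => k _; rewrite fixa.
have [/wj //|kJ] := boolP (k \in J).
have [p pJ [p0 ep]] := fix_out wJ wj kJ.
have [q qJ [q0 eq]] := fix_out (Jword_inv wJ) vj kJ.
have := fnVK (alpha k) ww; rewrite eq (add_fnD (fun x y => fnB x y ww)) ep (fixJ _ qJ).
rewrite -[RHS]addr0 -addrA => /addrI pq.
by rewrite (nonneg_antisym p0) ?addr0 // (addr0_eq pq).
Qed.

(** * Objects along alternating words and the braid relation *)

Lemma src_word a s : src (word C a s) = foldl (fun b i => rho C i b) a s.
Proof. by elim: s a => //= i s IH a; rewrite IH. Qed.

Lemma foldl_rhoK a s :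
  foldl (fun b i => rho C i b) (foldl (fun b i => rho C i b) a s) (rev s) = a.
Proof.
elim: s a => //= i s IH a.
by rewrite rev_cons -cats1 foldl_cat IH /= rho_invol.
Qed.

Lemma alt_rconsE i j m : alt i j m.*2.+1 = rcons (alt i j m.*2) i.
Proof. by rewrite alt_rcons odd_double. Qed.

Lemma alt_double i j m : alt j i m.*2 = alt j i m ++ rev (alt i j m).
Proof.
elim: m i j => // m IH i j.
rewrite doubleS [LHS]/= -/(alt i j m.*2.+1) alt_rconsE IH.
by rewrite rcons_cat /= rev_cons.
Qed.

Lemma iter_rho i j a m :
  iter m (rho C i \o rho C j) a = foldl (fun b i => rho C i b) a (alt j i m.*2).
Proof.
elim: m a => // m IH a.
by rewrite iterSr IH.
Qed.

(** The number in (R4) counts the positive roots supported in [i], [j]. The closed path of twice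
    that length from (R4) splits into one alternating word followed by the other one reversed, so
    both words end at the same object. *)
Lemma src_alt i j a : i != j ->
  let m := #|` fset_set (pos_roots [set i; j]%SET a)| in
  src (word C a (alt i j m)) = src (word C a (alt j i m)).
Proof.
move=> ij m; rewrite !src_word.
have [[_ _ _ R4] _] := hfin.
have /finite_setP[n Pn] := finite_pos_roots [set i; j]%SET a.
have mn : m = n := card_fset_set Pn.
have : rank2_part (R a) i j = pos_roots [set i; j]%SET a; last first.
  move=> e2; rewrite -e2 in Pn; have := R4 a i j n ij Pn.
  rewrite -mn iter_rho alt_double foldl_cat => e.
  have := foldl_rhoK (foldl (fun b l => rho C l b) a (alt j i m)) (rev (alt i j m)).
  by rewrite e revK.
apply/seteqP; split=> x.
  move=> [Rx [p [q xE]]]; split=> // k; rewrite xE ffunE !ffunMnE !alphaE.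
    by rewrite addr_ge0 ?mulrn_wge0.
  by rewrite !inE negb_or => /andP[/negbTE -> /negbTE ->]; rewrite !mul0rn.
move=> [Rx x0 xJ]; split=> //; exists `|x i|%N, `|x j|%N.
by rewrite [LHS](supported2_expand ij xJ) 2!pmulrn !gez0_abs.
Qed.

(** Both words have maximal length in the plane, hence negate all its positive roots. So
    [compm (invm u) v] and its inverse are nonnegative on the plane with determinant 1; [rank2_fix]
    and [Jword_fix] make the map the identity. *)
Lemma braid i j a : i != j ->
  let m := #|` fset_set (pos_roots [set i; j]%SET a)| in
  word C a (alt i j m) = word C a (alt j i m).
Proof.
move=> ij m; have eJ : [set j; i]%SET = [set i; j]%SET by rewrite finset.setUC.
set u := word C a (alt i j m); set v := word C a (alt j i m).
have uJ : Jword C [set i; j]%SET u by apply: Jword_alt.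
have vJ : Jword C [set i; j]%SET v by rewrite -eJ; apply: Jword_alt.
have uw := Jword_weyl uJ; have vw := Jword_weyl vJ.
have tu : tgt u = a by apply: tgt_word.
have tv : tgt v = a by apply: tgt_word.
have suv : src u = src v by apply: src_alt.
have du : all_desc [set i; j]%SET u.
  by apply/all_descP => //; rewrite tu ninv_alt.
have dv : all_desc [set i; j]%SET v.
  by apply/all_descP => //; rewrite tv ninv_alt // eJ.
(* [g] makes [alpha l] negative, and the inverse of [f] turns this vector positive again. *)
have pos_comp f g : Jword C [set i; j]%SET f -> Jword C [set i; j]%SET g ->
    tgt f = tgt g -> all_desc [set i; j]%SET f -> all_desc [set i; j]%SET g ->
    forall l, l \in [set i; j]%SET -> nonneg (fn (compm (invm f) g) (alpha l)).
  move=> fJ gJ e df dg l lJ; have fw := Jword_weyl fJ; have gw := Jword_weyl gJ.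
  have dg' : all_desc [set i; j]%SET (invm g).
    by apply: all_desc_invm; [exact: Jword_inv|rewrite (invmK gw)].
  have := dg' l lJ; rewrite /desc (invmK gw) => gl.
  rewrite /= -[fn g _]opprK (add_fnN (fun x y => fnB x y (weyl_inv fw))).
  apply: (all_desc_neg fw df) => // k kJ.
  by rewrite ffunE (Jword_supported gJ (supported_alpha lJ) kJ) oppr0.
have area_comp f g : Jword C [set i; j]%SET f -> Jword C [set i; j]%SET g ->
    (forall x y, supported [set i; j]%SET x -> supported [set i; j]%SET y ->
      area i j (fn f x) (fn f y) = (-1) ^+ m * area i j x y) ->
    (forall x y, supported [set i; j]%SET x -> supported [set i; j]%SET y ->
      area i j (fn g x) (fn g y) = (-1) ^+ m * area i j x y) ->
    area i j (fn (compm (invm f) g) (alpha i)) (fn (compm (invm f) g) (alpha j)) = 1.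
  move=> fJ gJ fA gA; have fw := Jword_weyl fJ; have gw := Jword_weyl gJ.
  have iJ : supported [set i; j]%SET (alpha i) by apply: supported_alpha; rewrite !inE eqxx.
  have jJ : supported [set i; j]%SET (alpha j) by apply: supported_alpha; rewrite !inE eqxx orbT.
  have hJ x : supported [set i; j]%SET x -> supported [set i; j]%SET (fn (compm (invm f) g) x).
    by move=> xJ; apply: (Jword_supported (Jword_inv fJ)); apply: Jword_supported.
  have := gA _ _ iJ jJ; rewrite -{1}(fnVK (fn g (alpha i)) fw) -{1}(fnVK (fn g (alpha j)) fw).
  rewrite fA; [|exact: hJ|exact: hJ].
  (* Both words have the same length, so their determinant signs cancel. *)
  move/(inv_inj (signrMK m)) => ->.
  by rewrite /area !alphaE !eqxx (negbTE ij) (eq_sym j) (negbTE ij).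
have uA x y : supported [set i; j]%SET x -> supported [set i; j]%SET y ->
    area i j (fn u x) (fn u y) = (-1) ^+ m * area i j x y.
  by move=> xJ yJ; rewrite area_word ?size_alt //; apply: alt_sub.
have vA x y : supported [set i; j]%SET x -> supported [set i; j]%SET y ->
    area i j (fn v x) (fn v y) = (-1) ^+ m * area i j x y.
  by move=> xJ yJ; rewrite area_word ?size_alt // -eJ; apply: alt_sub.
have yJ : Jword C [set i; j]%SET (compm (invm u) v).
  by apply: Jword_comp => //; [rewrite (src_invm uw) tu tv|exact: Jword_inv].
have zJ : Jword C [set i; j]%SET (compm (invm v) u).
  by apply: Jword_comp => //; [rewrite (src_invm vw) tu tv|exact: Jword_inv].
have : fn (compm (invm u) v) = id.
  apply: (Jword_fix yJ); apply: (@rank2_fix i j _ (fn (compm (invm v) u))) => //.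
  - by move=> x y; apply: fnB (Jword_weyl yJ).
  - by move=> x /=; rewrite (fnVK _ vw) (fnK _ uw).
  - by move=> l lJ; apply/(Jword_supported yJ)/supported_alpha.
  - by move=> l lJ; apply/(Jword_supported zJ)/supported_alpha.
  - by apply: pos_comp; rewrite ?tu ?tv.
  - by apply: pos_comp; rewrite ?tu ?tv.
  - exact: area_comp.
  - exact: area_comp.
move=> e; have fuv : fn u = fn v.
  apply/funext => x; rewrite -[RHS](fnVK _ uw).
  by move/(congr1 (fun f => fn u (f x))): e => /= ->.
move: tu tv suv fuv.
by case: u v {uJ vJ uw vw du dv uA vA yJ zJ e} => [? ? ?] [? ? ?] /= -> -> -> ->.
Qed.


(** * Exchange property, length and weak order *)

Local Notation has_word := (has_word_of_size C).

Lemma has_word_weyl w (k : nat) : has_word w k -> weyl C w.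
Proof. by case=> s _ ->; apply: weyl_word. Qed.

Lemma has_word_lmul i w (k : nat) : has_word w k -> has_word (lmul C i w) k.+1.
Proof.
move=> [s sk ew]; exists (i :: s); first by rewrite /= sk.
by rewrite word_cons tgt_lmul rho_invol -ew.
Qed.

Lemma has_word_ge w (k : nat) : has_word w k -> (ninv w <= k)%N.
Proof. by move=> [s <- ->]; apply: ninv_word. Qed.

Lemma word_has_word a s : has_word (word C a s) (size s).
Proof. by exists s; rewrite ?tgt_word. Qed.

(** Stated for one length [k] at a time, with [w] given by a reduced word, so that strong induction
    on [k] applies. *)
Definition exchange (k : nat) := forall w j, has_word w k -> ninv w = k -> desc j w ->
  has_word (lmul C j w) k.-1.

(** A letter just removed is no longer a descent, so the removed letters alternate, beginning with
    [j], until neither [i] nor [j] is a descent of the rest. *)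
Lemma strip_alt (k : nat) i j w : (forall l, (l <= k)%N -> exchange l) -> i != j ->
  has_word w k -> ninv w = k -> ~ desc i w ->
  exists m t, [/\ (m + size t)%N = k, w = word C (tgt w) (alt j i m ++ t),
    ~ desc i (word C (src (word C (tgt w) (alt j i m))) t)
    & ~ desc j (word C (src (word C (tgt w) (alt j i m))) t)].
Proof.
elim: k i j w => [|k IH] i j w ex ij wk nw di;
  (have [dj|dj] := pselect (desc j w);
    last by case: wk => s sk ew; exists 0%N, s; rewrite /= -?ew).
- by have := ninv_lmul_desc (has_word_weyl wk) dj; rewrite nw.
- have ww := has_word_weyl wk.
  have vk := ex _ (leqnn _) _ _ wk nw dj; rewrite /= in vk.
  have nv : ninv (lmul C j w) = k by have := ninv_lmul_desc ww dj; rewrite nw => -[].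
  have dv : ~ desc j (lmul C j w) by move/(desc_lmul j ww).
  have [||m [t [mt ev d1 d2]]] := IH j i (lmul C j w) _ _ vk nv dv.
  + by move=> l lk; apply: ex; rewrite leqW.
  + by rewrite eq_sym.
  exists m.+1, t; split; first by rewrite addSn mt.
  + by rewrite -[LHS](lmulK C j) ev cat_cons word_cons tgt_lmul.
  + by move: d2; rewrite tgt_lmul.
  + by move: d1; rewrite tgt_lmul.
Qed.

(** With first letter [i] different from [j], stripping the tail writes [w] as an alternating word
    [x] times [v]. The braid relation lets [x] begin with [j] instead, and this letter cancels. *)
Lemma exchangeP (k : nat) : exchange k.
Proof.
elim/ltn_ind: k => k IH w j wk nw dj; have ww := has_word_weyl wk.
case: (wk) => -[|i s] sk ew.
  by have := ninv_lmul_desc ww dj; rewrite nw -sk.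
rewrite /= in sk; rewrite word_cons in ew.
set a := tgt w in ew *; set w1 := word C (rho C i a) s in ew.
have w1w : weyl C w1 by apply: weyl_word.
have [<-|ij] := eqVneq i j; first by rewrite -sk ew lmulK; apply: word_has_word.
have n1 : ninv w1 = size s.
  apply/eqP; rewrite eqn_leq ninv_word -ltnS sk -nw ew.
  exact: ninv_lmul_le.
have d1 : ~ desc i w1.
  by move/(ninv_lmul_desc w1w); rewrite -ew nw n1 -sk => /eqP; rewrite ltn_eqF // ltnW.
have di : desc i w by rewrite ew; apply/desc_lmul.
have ex l : (l <= size s)%N -> exchange l by move=> ls; apply: IH; rewrite -sk.
have [m [t [mt ew1 dvi dvj]]] := strip_alt ex ij (word_has_word _ _) n1 d1.
rewrite tgt_word in ew1 dvi dvj.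
have {}ew : w = word C a (alt i j m.+1 ++ t) by rewrite ew [w1]ew1 word_cons.
set x := word C a (alt i j m.+1); set b := src x; set v := word C b t.
have xJ : Jword C [set i; j]%SET x by apply: Jword_alt.
have xw := Jword_weyl xJ; have vw : weyl C v by apply: weyl_word.
have bE : src (word C (rho C i a) (alt j i m)) = b by [].
rewrite bE -/v in dvi dvj.
have wE : w = compm x v by rewrite ew word_cat.
have xv : src x = tgt v by rewrite tgt_word.
(* A left factor of a reduced word is reduced, by subadditivity of [ninv]. *)
have nx : ninv x = m.+1.
  apply/eqP; rewrite eqn_leq; apply/andP; split.
    by rewrite (leq_trans (ninv_word _ _)) ?size_alt.
  rewrite -(leq_add2r (size t)) addSn mt sk -nw wE.
  by rewrite (leq_trans (ninv_comp xw vw xv)) // leq_add2l ninv_word.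
have dx : all_desc [set i; j]%SET x.
  (* A positive preimage of [alpha l] under [x] lies in the plane, so the inverse of [v] would keep
     it positive, against [l] being a descent of [w]. *)
  move=> l lJ; have [//|/(ndesc xw) l0] := pselect (desc l x).
  have dl : desc l w by move: lJ; rewrite !inE => /orP[] /eqP ->.
  case: (root_pos_neg (root_invm l ww)) => //.
  rewrite wE (invm_comp xv xw vw) /=.
  apply: (add_fn_nonneg (fun x y => fnB x y (weyl_inv vw)) (J := [set i; j]%SET)) => //.
    exact: (Jword_supported (Jword_inv xJ) (supported_alpha lJ)).
  by move=> p; rewrite !inE => /orP[] /eqP ->; apply: ndesc.
have xM : m.+1 = #|` fset_set (pos_roots [set i; j]%SET a)|.
  by have /all_descP := dx; rewrite tgt_word nx; apply.
have xE : x = word C a (alt j i m.+1).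
  by rewrite /x xM; apply: braid.
have -> : lmul C j w = word C (rho C j a) (alt i j m ++ t).
  rewrite wE /v /b xE -word_cat cat_cons word_cons lmulK //.
rewrite (_ : k.-1 = size (alt i j m ++ t)); first exact: word_has_word.
by rewrite -sk size_cat size_alt mt.
Qed.

(** Left multiplication by a non-descent adds a letter; for a descent the exchange property removes
    one. *)
Lemma has_word_ninv w : weyl C w -> has_word w (ninv w).
Proof.
elim/weyl_ind => [a|i {}w ww IH]; first by rewrite ninv_id; exists [::].
have [dw|dw] := pselect (desc i w); last by rewrite ninv_lmul //; apply: has_word_lmul.
by have := exchangeP IH erefl dw; rewrite (ninv_lmul_desc ww dw).
Qed.

Lemma len_ninv w : weyl C w -> len C w = ninv w.
Proof.
move=> ww; rewrite /len; set S := (X in xget _ X).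
(* The set of minimal lengths is inhabited, so the default 0 of [xget] is not what is returned. *)
have Sn : S (ninv w) by split; [exact: has_word_ninv|exact: has_word_ge].
have [lw lmin] : S (xget 0%N S) by apply: xgetPex; exists (ninv w).
by apply/eqP; rewrite eqn_leq has_word_ge // lmin //; apply: has_word_ninv.
Qed.

Lemma ninv0 w : weyl C w -> ninv w = 0%N -> w = idm I (tgt w).
Proof. by move=> /has_word_ninv [s + +] n0; rewrite n0 => /size0nil ->. Qed.

Lemma leR_ninv u w : leR C u w <-> weyl C u /\
  exists v, [/\ weyl C v, src u = tgt v, w = compm u v & (ninv u + ninv v)%N = ninv w].
Proof.
split=> -[uw [v [vw e ew l]]]; split=> //; exists v; split=> //.
all: have ww : weyl C w by rewrite ew; apply: weyl_comp.
  by rewrite -!len_ninv.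
by rewrite !len_ninv.
Qed.

Lemma leR_refl w : weyl C w -> leR C w w.
Proof.
move=> ww; apply/leR_ninv; split=> //; exists (idm I (src w)).
by split; [apply: weyl_id| |rewrite compm1r|rewrite ninv_id addn0].
Qed.

Lemma leR_trans u v w : leR C u v -> leR C v w -> leR C u w.
Proof.
move=> /leR_ninv[uw [p [pw up ev np]]] /leR_ninv[vw [q [qw vq ew nq]]].
have pq : src p = tgt q by rewrite -vq ev.
apply/leR_ninv; split=> //; exists (compm p q); split=> //.
- exact: weyl_comp.
- by rewrite ew ev compmA.
(* Both inequalities come from subadditivity, for [compm p q] and for [w]. *)
apply/eqP; rewrite eqn_leq; apply/andP; split.
  by rewrite -nq -np -addnA leq_add2l; apply: ninv_comp.
by rewrite ew ev -compmA; apply: ninv_comp => //; apply: weyl_comp.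
Qed.

Lemma desc_leR i w : weyl C w -> desc i w <-> leR C (word C (tgt w) [:: i]) w.
Proof.
move=> ww; have -> : word C (tgt w) [:: i] = lmul C i (idm I (rho C i (tgt w))).
  by rewrite word_cons.
have nid b : ninv (lmul C i (idm I b)) = 1%N.
  rewrite ninv_lmul ?ninv_id //; first exact: weyl_id.
  exact: ndesc_id.
rewrite leR_ninv; split=> [dw|[_ [v [vw e ew nw]]]].
  split; first exact/weyl_lmul/weyl_id.
  exists (lmul C i w); split=> //; first exact: weyl_lmul.
    by rewrite compm_lmul compm1l ?lmulK.
  by rewrite nid add1n (ninv_lmul_desc ww dw).
rewrite compm_lmul compm1l // in ew; rewrite ew; apply/desc_lmul => // dv.
have := ninv_lmul_desc vw dv; rewrite -ew -nw nid => /eqP.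
by rewrite add1n ltn_eqF // ltnW.
Qed.

(** * Parabolic subgroupoids *)

Lemma parabolicP J w : parabolic C J w <-> Jword C J w.
Proof.
split=> [|wJ].
  apply; split=> [|_ [j [b [jJ ->]]]]; last first.
    by apply: (Jword_lmul jJ (Jword_id C J b)).
  split=> [u|b|u v uJ vJ e|u v uJ vw e1 e2 e3 e4].
  - exact: Jword_weyl.
  - exact: Jword_id.
  - exact: Jword_comp.
  (* Uniqueness of inverses identifies [v] with [invm u]. *)
  rewrite -(invm_eq (Jword_weyl uJ) (And4 e1 e2 e3 e4)); exact: Jword_inv.
move=> G [[_ Gid Gcomp _] Ggen].
elim/Jword_ind: wJ => // i {}w iJ _ IH; apply: Gcomp => //.
by apply: Ggen; exists i, (tgt w).
Qed.

(** The inverse of [w] keeps every simple root positive: inside [J] by hypothesis, outside because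
    the coordinate at [k] stays 1. Hence there are no inversions and the length is 0. *)
Lemma Jword_nodesc J w : Jword C J w -> (forall j, j \in J -> ~ desc j w) ->
  w = idm I (tgt w).
Proof.
move=> wJ dw; have ww := Jword_weyl wJ; have vw := weyl_inv ww.
apply: ninv0 => //; rewrite -(ninv_invm ww) /ninv.
rewrite (_ : inversions _ = set0) ?fset_set0 ?cardfs0 // -subset0 => x [Rx x0 x1].
apply: (root_pos_neg (root_fn vw Rx)) => //.
apply: (add_fn_nonneg (fun x y => fnB x y vw) (J := [set: I]%SET)) => // [k|k _].
  by rewrite inE.
have [kJ|kJ] := boolP (k \in J); first exact/ndesc/dw.
apply: (@root_coord_gt0 _ _ k (root_invm k ww)).
by rewrite (Jword_out _ (Jword_inv wJ) kJ) alphaE eqxx.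
Qed.

(** Descents in [J] are split off one at a time, by induction on the length. *)
Lemma parabolic_decomp J w : weyl C w -> exists x y : mor I A,
  [/\ Jword C J x, weyl C y, src x = tgt y /\ w = compm x y,
    (ninv x + ninv y)%N = ninv w & forall j, j \in J -> ~ desc j y].
Proof.
move: {2}(ninv w) (erefl (ninv w)) => n; elim: n w => [|n IH] w nw ww;
  have [[j [jJ dj]]|/forallNP dw] := pselect (exists j, j \in J /\ desc j w).
- by have := ninv_lmul_desc ww dj; rewrite nw.
- exists (idm I (tgt w)), w; split=> //; [exact: Jword_id|by rewrite compm1l|
    by rewrite ninv_id|by move=> j jJ dj; apply: (dw j)].
- have nv : ninv (lmul C j w) = n by have := ninv_lmul_desc ww dj; rewrite nw => -[].
  have [x [y [xJ yw [xy ev] nxy dy]]] := IH _ nv (weyl_lmul j ww).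
  have wE : w = compm (lmul C j x) y by rewrite compm_lmul -ev lmulK.
  exists (lmul C j x), y; split=> //; first exact: Jword_lmul.
  (* A letter adds at most 1 to [x], and subadditivity gives the other bound, so lengths still add
     up. *)
  apply/eqP; rewrite eqn_leq; apply/andP; split.
    by rewrite nw -nv -nxy -addSn leq_add2r ninv_lmul_le //; apply: Jword_weyl xJ.
  by rewrite [in X in (X <= _)%N]wE ninv_comp //; apply/weyl_lmul/(Jword_weyl xJ).
- exists (idm I (tgt w)), w; split=> //; [exact: Jword_id|by rewrite compm1l|
    by rewrite ninv_id|by move=> j jJ dj; apply: (dw j)].
Qed.

(** Right multiplication by a reflection is left multiplication on the inverse, where [j] is not a
    descent. *)
Lemma Jword_extend J w j : Jword C J w -> j \in J -> ~ desc j (invm w) ->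
  exists v, [/\ Jword C J v, tgt v = tgt w, leR C w v & ninv v = (ninv w).+1].
Proof.
move=> wJ jJ dj; have ww := Jword_weyl wJ; have vw := weyl_inv ww.
exists (invm (lmul C j (invm w))).
have n1 : ninv (invm (lmul C j (invm w))) = (ninv w).+1.
  by rewrite ninv_invm ?ninv_lmul ?ninv_invm //; apply: weyl_lmul.
split=> //.
- by apply/Jword_inv/Jword_lmul => //; apply: Jword_inv.
- by rewrite (tgt_invm (weyl_lmul j vw)) src_lmul (src_invm ww).
apply/leR_ninv; split=> //; exists (sigmam C j (rho C j (src w))).
split; [exact: weyl_sigma|by rewrite /= rho_invol|by rewrite invm_lmul ?(invmK ww) ?(tgt_invm ww)|].
rewrite n1 -addn1; congr addn.
rewrite (_ : sigmam _ _ _ = lmul C j (idm I (rho C j (src w)))) //.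
rewrite ninv_lmul ?ninv_id //; first exact: weyl_id.
exact: ndesc_id.
Qed.

(** * Longest elements and their order *)

Lemma ex_all_desc J a : exists w, [/\ Jword C J w, tgt w = a & all_desc J w].
Proof.
have [//|no] := pselect (exists w, [/\ Jword C J w, tgt w = a & all_desc J w]).
(* Otherwise every element could be extended on the right, so all lengths would occur. *)
have big n : exists w, [/\ Jword C J w, tgt w = a & ninv w = n].
  elim: n => [|n [w [wJ ta nw]]].
    by exists (idm I a); split; [exact: Jword_id| |rewrite ninv_id].
  have [dw|] := pselect (all_desc J (invm w)).
    by case: no; exists w; split=> //; apply: all_desc_invm.
  move=> /existsNP[j /not_implyP[jJ dj]].
  have [v [vJ tv _ nv]] := Jword_extend wJ jJ dj.
  by exists v; split; rewrite ?tv ?nv ?nw.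
have [w [wJ ta nw]] := big #|` fset_set (pos_roots J a)|.+1.
by have := ninv_le_pos_roots wJ; rewrite nw ta ltnn.
Qed.

(** The quotient [compm (invm v) w] has no descent in [J]: [v] makes [alpha j] negative and the
    inverse of [w] makes it positive again. So it is an identity. *)
Lemma all_desc_uniq J v w : Jword C J v -> Jword C J w -> tgt v = tgt w ->
  all_desc J v -> all_desc J w -> v = w.
Proof.
move=> vJ wJ e dv dw; have vw := Jword_weyl vJ; have ww := Jword_weyl wJ.
have ew : src (invm v) = tgt w by rewrite (src_invm vw).
have yJ : Jword C J (compm (invm v) w) by apply: Jword_comp => //; apply: Jword_inv.
have := Jword_nodesc yJ; rewrite tgt_compm (tgt_invm vw) => y1.
have {}y1 : compm (invm v) w = idm I (src v).
  apply: y1 => j jJ dj.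
  case: (root_pos_neg (root_invm j (Jword_weyl yJ))) => //.
  rewrite (invm_comp ew (weyl_inv vw) ww) (invmK vw) /=.
  have dv' : all_desc J (invm v).
    by apply: all_desc_invm; [exact: Jword_inv|rewrite (invmK vw)].
  have := dv' j jJ; rewrite /desc (invmK vw) => vj.
  rewrite -[fn v _]opprK (add_fnN (fun x y => fnB x y (weyl_inv ww))).
  apply: (all_desc_neg ww dw) => // k kJ.
  by rewrite ffunE (Jword_supported vJ (supported_alpha jJ) kJ) oppr0.
by rewrite -[w](compm1l (erefl _)) -e -(compmV vw) -compmA y1 compm1r.
Qed.

Lemma all_desc_longest J w : Jword C J w -> all_desc J w -> longest C (tgt w) J = w.
Proof.
move=> wJ dw; have ww := Jword_weyl wJ.
set P := [set u | unique (maximal_in (HomTo (parabolic C J) (tgt w)) (leR C)) u].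
have Pw : P w.
  split=> [|v [[/parabolicP vJ tv] vmax]]; last first.
    apply: (all_desc_uniq (J := J)) => //.
    (* A maximal [v] whose inverse misses a descent in [J] could be extended properly. *)
    have vw := Jword_weyl vJ; apply: all_desc_invm => // j jJ.
    have [//|dj] := pselect (desc j (invm v)).
    have [u [uJ tu vu nu]] := Jword_extend vJ jJ dj.
    have uv : u = v by apply: vmax => //; split; [apply/parabolicP|rewrite tu].
    by move: nu => /eqP; rewrite uv ltn_eqF.
  split=> [|v [/parabolicP vJ tv] /leR_ninv[_ [y [yw wy ev nv]]]].
    by split; first exact/parabolicP.
  (* [w] already has the largest possible length, so nothing of positive length can be appended. *)
  have ny : ninv y = 0%N.
    apply/eqP; rewrite -leqn0 -(leq_add2l (ninv w)) nv addn0.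
    by have /(all_descP wJ) -> := dw; rewrite -tv ninv_le_pos_roots.
  by rewrite ev (ninv0 yw ny) -wy compm1r.
have := xgetPex (idm I (tgt w)) (ex_intro _ w Pw).
rewrite -/(longest C (tgt w) J) => -[lmax _].
by case: Pw => _ /(_ _ lmax).
Qed.

Lemma longestP J a : let w := longest C a J in
  [/\ Jword C J w, tgt w = a & all_desc J w].
Proof.
have [w [wJ <- dw]] := ex_all_desc J a.
by rewrite (all_desc_longest wJ dw).
Qed.

Lemma longest_leR J w : weyl C w -> leR C (longest C (tgt w) J) w <-> all_desc J w.
Proof.
move=> ww; have [lJ ta dl] := longestP J (tgt w).
have lw := Jword_weyl lJ; split=> [lew j jJ|dw].
  apply/desc_leR => //; apply: leR_trans lew.
  by rewrite -[X in word C X]ta; apply/desc_leR => //; apply: dl.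
have [x [y [xJ yw [xy ew] nw dy]]] := parabolic_decomp J ww.
have xw := Jword_weyl xJ.
(* By uniqueness [x] is then the longest element, and [y] is the required complement. *)
suff dx : all_desc J x.
  rewrite (_ : tgt w = tgt x) ?(all_desc_longest xJ dx); last by rewrite ew.
  by apply/leR_ninv; split=> //; exists y.
move=> j jJ; have [//|/(ndesc xw) j0] := pselect (desc j x).
case: (root_pos_neg (root_invm j ww)); last exact: dw.
(* As [y] has no descent in [J], its inverse keeps a positive vector supported in [J] positive. *)
rewrite ew (invm_comp xy xw yw) /=.
apply: (add_fn_nonneg (fun x y => fnB x y (weyl_inv yw)) (J := J)) => //.
  exact: (Jword_supported (Jword_inv xJ) (supported_alpha jJ)).
by move=> k kJ; apply/ndesc/dy.
Qed.

(** For [i] outside [J], the inverse of the longest element keeps the coordinate of [alpha i] at [i]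
    equal to 1, so [i] is no descent. *)
Lemma longest_desc J a i : desc i (longest C a J) <-> i \in J.
Proof.
have [lJ ta dl] := longestP J a; split=> [di|]; last exact: dl.
have lw := Jword_weyl lJ; apply: contrapT => /negP iJ.
have := di i; rewrite ffunE (Jword_out _ (Jword_inv lJ) iJ) alphaE eqxx.
by [].
Qed.

Lemma longest_leR_longest J K a :
  leR C (longest C a J) (longest C a K) <-> J \subset K.
Proof.
have [lJ ta dl] := longestP K a.
rewrite -{1}ta (longest_leR J (Jword_weyl lJ)).
split=> [dJ|/fintype.subsetP JK j /JK]; last exact: dl.
by apply/fintype.subsetP => j /dJ /longest_desc.
Qed.

Lemma left_descents_subset J w : weyl C w ->
  J \subset left_descents C (tgt w) w <-> all_desc J w.
Proof.
move=> ww; split=> [/fintype.subsetP JD j /JD|dJ].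
  by rewrite inE => /asboolP /desc_leR; apply.
apply/fintype.subsetP => j jJ; rewrite inE; apply/asboolP/desc_leR => //.
exact: dJ.
Qed.

End FiniteRootSystem.

Theorem proposition3p7 (I A : finType) (C : cartan_scheme I A)
    (hfin : finite_root_system C (real_roots C))
    (a : A) (w : mor I A) (hw : HomTo (weyl C) a w) :
  poset_iso
    [set J : {set I} | J \subset left_descents C a w]
    (fun J K : {set I} => J \subset K)
    (left_descent_longest C a w)
    (leR C)
    (longest C a).
Proof.
case: hw => ww <-; split=> [|J K _ _]; last by rewrite longest_leR_longest.
split.
- move=> J /= /(left_descents_subset hfin J ww) dJ; exists J => //=.
  exact/(longest_leR hfin).
(* Injectivity: equal longest elements are below each other, so [J] and [K] include each other. *)
- move=> J K _ _ e; apply/eqP; rewrite finset.eqEsubset.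
  apply/andP; split; apply/(longest_leR_longest hfin _ _ (tgt w)); rewrite e;
  by apply/(leR_refl hfin)/(@Jword_weyl _ _ C K); case: (longestP hfin K (tgt w)).
- move=> _ [J /= lJ <-]; exists J => //=.
  by apply/(left_descents_subset hfin) => //; apply/(longest_leR hfin).
Qed.
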